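(* Let $G$ be a connected ribbon graph with edge set $E(G)=\{e_1,\dots,e_m\}$, let $k$ be a positive integer and let $A\subseteq E(G)$. Then the partial dual $G^{\delta(A)}$ is $k$-regular if and only if there exist a spanning quasi-tree $Q$ of $G$ and a shorter marking arrow sequence set $S=\{C_1,\dots,C_n\}$ of the bouquet $G^{\delta(E(Q))}$ with $n=\frac{2m}{k}-1$ and $d(C_i)=k$ for $i=1,\dots,n$, such that $$A=E(Q)\,\Delta\,\{e_1,\dots,e_n\},$$ where here $e_i$ denotes the edge corresponding to (i.e. the initial edge of) $C_i$, $i=1,\dots,n$, and $\Delta$ is symmetric difference.
   Context: A ribbon graph $G=(V(G),E(G))$ is a (possibly non-orientable) surface with boundary written as the union of two sets of closed discs, the vertices $V(G)$ and the edges $E(G)$, such that vertices and edges meet in disjoint line segments (common line segments), each common line segment lies on the boundary of exactly one vertex and exactly one edge, and each edge contains exactly two common line segments. The degree of a vertex is the number of common line segments on its boundary; $G$ is $k$-regular if every vertex has degree $k$. A bouquet is a ribbon graph with exactly one vertex. A quasi-tree is a ribbon graph with exactly one boundary component; a spanning quasi-tree $Q$ of $G$ is a ribbon subgraph containing all vertices of $G$ (and a subset $E(Q)$ of the edges) that is a quasi-tree. Arrow presentation: a ribbon graph is described by a set of circles (the vertex boundaries) carrying, for each edge $e$, two marking arrows labelled $e$, one on each common line segment of $e$; the ribbon graph is recovered by filling each circle with a disc and, for each label $e$, attaching an edge disc along the two arcs carrying the $e$-arrows so that the directions of the two arrows agree along the edge. Partial dual $G^{\delta(A)}$ for $A\subseteq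 E(G)$: for each $e\in A$ with arrows $e',e''$, draw a line segment directed from the head of $e'$ to the tail of $e''$ and one directed from the head of $e''$ to the tail of $e'$, label both arrows $e$, and delete the arcs carrying $e'$ and $e''$. Edges of $G$ and of $G^{\delta(A)}$ are identified naturally. For $A\subseteq E(G)$, $G^{\delta(A)}$ is a bouquet if $A$ is the edge set of a spanning quasi-tree. Shorter marking arrow sequences: let $H$ be a bouquet with $m$ edges and let $C$ be the circle of its arrow presentation, with its $2m$ marking arrows read in a fixed cyclic (clockwise) order. For an edge $e$ of $H$, its two marking arrows split the cyclic sequence into two arcs: one starts at the first arrow of $e$ and continues up to but not including the second arrow of $e$; the other starts at the second arrow of $e$ and continues up to but not including the first. A shorter marking arrow sequence $D_e$ of $e$ is the arc containing fewer marking arrows (either one if they contain equally many); $e$ is called the corresponding (initial) edge of $D_e$. Fix one such $D_e$ for each edge, and let $\mathcal{C}(H)$ be the set of these. A subset $\{C_1,\dots,C_n\}\subseteq\mathcal{C}(H)$ is a shorter marking arrow sequence set if the initial edge of each $C_i$ is an orientable loop (the ribbon subgraph consisting of the vertex and that edge is orientable) and for any $i,j$, viewing arcs as sets of marking-arrow positions on $C$, either $C_i\subseteq C_j$, $C_j\subseteq C_i$, or $C_i\cap C_j=\emptyset$. The empty set is also a shorter marking arrow sequence set. The length $d(C_k)$ is the number of marking arrows in $C_k\setminus\bigcup_{i\ne k}C_i$.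
   Formalization: The length d(C_k) counts the marking arrows of C_k outside those C_i properly contained in C_k, not outside all other C_i; with the literal union a nested sequence has length 0 and the claim fails for the plane 4-cycle with A empty and k=2. *)

(* Defs.v *)
From mathcomp Require Import all_boot.

Set Implicit Arguments.
Unset Strict Implicit.
Unset Printing Implicit Defensive.

(* Ribbon graphs are given by arrow presentations.  An edge e carries two
   marking arrows (e, false) and (e, true); an arrow a has two end points,
   its tail (a, false) and its head (a, true), which are the end points of a
   common line segment. *)
Definition arrow (E : finType) : finType := (E * bool)%type.
Definition point (E : finType) : finType := (arrow E * bool)%type.

(* The circles with their arrows are recorded by the involution [link], which
   exchanges the two ends of each arc of circle lying between two consecutive
   arrows (the two ends of the only such arc when a circle carries a single
   arrow, so that link then exchanges the tail and the head of that arrow).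
   Circles without arrows, i.e. isolated vertices, are only counted. *)
Record ribbon_graph (E : finType) := RibbonGraph {
  link : point E -> point E;
  link_invol : involutive link;
  link_neq : forall x, link x != x;
  isolated : nat
}.

Section RibbonGraphs.

Variable E : finType.
Implicit Types (G H : ribbon_graph E) (A B Q : {set E}) (e : E).
Implicit Types (x y : point E) (a : arrow E) (C : {set arrow E}).

Definition edge_of x : E := x.1.1.

(* Along the common line segment, from one end of an arrow to the other. *)
Definition across x : point E := (x.1, ~~ x.2).

(* Along a free side of an edge disc: the two arrows of e follow one
   orientation of the boundary of the disc, so its free sides join the head of
   each arrow of e to the tail of the other. *)
Definition side x : point E := ((x.1.1, ~~ x.1.2), ~~ x.2).

(* The classes of points joined by r, one for each component carrying a point,
   followed by one empty set for each isolated vertex, which is a component by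
   itself and carries no point. *)
Definition components G (r : rel (point E)) : seq {set point E} :=
  enum (equivalence_partition (connect r) [set: point E])
    ++ nseq (isolated G) set0.

Definition vertices G : seq {set point E} :=
  components G [rel x y | (y == link G x) || (y == across x)].

Definition connected G : Prop :=
  size (components G
    [rel x y | [|| y == link G x, y == across x | y == side x]]) = 1.

(* The number of common line segments on the boundary of a vertex. *)
Definition degree (v : {set point E}) : nat := #|[set a | (a, false) \in v]|.

Definition regular (k : nat) G : Prop :=
  forall v, v \in vertices G -> degree v = k.

(* Boundary components of the spanning ribbon subgraph (V(G), B): at a common
   line segment the boundary turns along the free side of the edge if that
   edge is in B, and stays on the vertex boundary otherwise. *)
Definition boundary_components G B : seq {set point E} :=
  components G
    [rel x y | (y == link G x) ||
               (y == if edge_of x \in B then side x else across x)].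

Definition spanning_quasi_tree G Q : Prop :=
  size (boundary_components G Q) = 1.

(* Orientability of the spanning ribbon subgraph (V(G), B).  The circles are
   oriented by [o], where o x says that the circle runs through the arrow of x
   starting at x.  The edge disc of e can be oriented compatibly with the
   vertex discs exactly when its two arrows both follow, or both oppose, the
   orientations of the circles they lie on. *)
Definition orientable G B : Prop :=
  exists o : point E -> bool,
    [/\ forall x, o (across x) = ~~ o x,
        forall x, o (link G x) = ~~ o x
      & forall e, e \in B -> o ((e, false), false) = o ((e, true), false)].

Definition orientable_loop H e : Prop := orientable H [set e].

(* Partial duality.  For e in A, the new arrow (e, b) goes from the head of the
   old arrow (e, b) to the tail of the old arrow (e, ~~ b), and the arcs
   carrying the old arrows are deleted; the other arcs of circle are kept.
   [old_point A x] is the place, among the end points of the old arrows, of the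
   end point x of a new arrow. *)
Definition old_point A x : point E :=
  if edge_of x \in A then
    if x.2 then ((x.1.1, ~~ x.1.2), false) else (x.1, true)
  else x.

Definition new_point A x : point E :=
  if edge_of x \in A then
    if x.2 then (x.1, false) else ((x.1.1, ~~ x.1.2), true)
  else x.

Lemma old_pointK A : cancel (old_point A) (new_point A).
Proof.
case=> [[e b] h]; rewrite /old_point /new_point /edge_of /=.
by case eA: (e \in A); case: h; rewrite /= eA ?negbK.
Qed.

Lemma new_pointK A : cancel (new_point A) (old_point A).
Proof.
case=> [[e b] h]; rewrite /old_point /new_point /edge_of /=.
by case eA: (e \in A); case: h; rewrite /= eA ?negbK.
Qed.

Definition dual_link G A x : point E := new_point A (link G (old_point A x)).

Lemma dual_link_invol G A : involutive (dual_link G A).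
Proof. by move=> x; rewrite /dual_link new_pointK link_invol old_pointK. Qed.

Lemma dual_link_neq G A x : dual_link G A x != x.
Proof.
apply/eqP => /(congr1 (old_point A)); rewrite /dual_link new_pointK.
by apply/eqP; apply: link_neq.
Qed.

Definition partial_dual G A : ribbon_graph E :=
  RibbonGraph (@dual_link_invol G A) (@dual_link_neq G A) (isolated G).

(* [s] lists the marking arrows of the bouquet H in their cyclic order around
   its circle, read in one of the two directions.  [p] lists, in that order,
   the end point at which each arrow is entered. *)
Definition cyclic_reading H (s : seq (arrow E)) : Prop :=
  exists p : seq (point E),
    [/\ fcycle (link H \o across) p, s = [seq x.1 | x <- p],
        uniq s & forall a, a \in s].

(* From the arrow (e, b), included, up to the other arrow of e, excluded. *)
Definition arrow_arc (s : seq (arrow E)) e (b : bool) : {set arrow E} :=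
  [set a in arc s (e, b) (e, ~~ b)].

Definition shorter_sequence (s : seq (arrow E)) e C : Prop :=
  exists2 b : bool, C = arrow_arc s e b
                  & #|arrow_arc s e b| <= #|arrow_arc s e (~~ b)|.

(* In the next definitions, D e is the shorter marking arrow sequence chosen
   for the edge e. *)
Definition shorter_sequence_set H (D : E -> {set arrow E})
    (S : {set {set arrow E}}) : Prop :=
  [/\ S \subset [set D e | e : E],
      forall e, D e \in S -> orientable_loop H e
    & forall C1 C2, C1 \in S -> C2 \in S ->
        [|| C1 \subset C2, C2 \subset C1 | [disjoint C1 & C2]] ].

Definition initial_edges (D : E -> {set arrow E}) (S : {set {set arrow E}}) :
  {set E} := [set e | D e \in S].

(* Only the members of S nested inside C are removed from it: removing also
   those that contain C would give length 0 to every nested sequence. *)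
Definition seq_length (S : {set {set arrow E}}) C : nat :=
  #|C :\: \bigcup_(C' in S | C' \proper C) C'|.

Definition symdiff A B : {set E} := (A :\: B) :|: (B :\: A).

End RibbonGraphs.

(* Main.v *)
Require Import Defs.
From mathcomp Require Import all_boot all_order all_algebra.

(** Call faces of (G, B) the boundary components of the spanning ribbon subgraph
    (V(G), B); the vertices of [partial_dual G A] are the faces of (G, A), and a
    vertex of degree d carries 2d end points.  Adding or removing one edge
    changes the number of faces by at most one, and it merges two faces when the
    two sides of the edge lie on different faces.  So if G is connected and
    (G, A) has n + 1 faces, merging them along n edges gives a set T with n
    elements such that Q = A \Delta T is a spanning quasi-tree.  In the bouquet
    H = [partial_dual G Q], (H, T) has n + 1 faces, the most that n edges can
    produce; this forces the edges of T to be orientable loops that are pairwise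
    not interlaced, so that their shorter sequences are nested or disjoint.
    Conversely, let T be any set of orientable loops of a bouquet with nested or
    disjoint sequences.  The set of sequences that contain an arc of the circle
    is constant along each face of (H, T); it takes n + 1 values, one for each
    sequence (its innermost part) and one for the outside of all of them.  As
    there are at most n + 1 faces, the faces are exactly the fibres of this
    function, and their degrees are the lengths d(C_i) and 2m - \sum d(C_i). *)

Set Implicit Arguments.
Unset Strict Implicit.
Unset Printing Implicit Defensive.

(** * Counting and parity *)

Section ImageCounting.

Variables (T U V : finType) (g : T -> U) (h : T -> V).

(** [k] reads [g] at a preimage under [h]; off the image of [h] it takes the default value
    [g x0]. *)
Lemma imset_factor (x0 : T) :
  (forall x y, h x = h y -> g x = g y) ->
  exists k : V -> U, forall x, g x = k (h x).
Proof.
move=> hg; exists (fun v => g (odflt x0 [pick x | h x == v])) => x.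
by apply: hg; case: pickP => [y /eqP->|/(_ x)] //=; rewrite eqxx.
Qed.

Lemma leq_card_image :
  (forall x y, h x = h y -> g x = g y) ->
  #|g @: [set: T]| <= #|h @: [set: T]|.
Proof.
move=> hg; case: (pickP T) => [x0 _|T0].
  have [k gk] := imset_factor x0 hg; rewrite (eq_imset _ gk).
  by rewrite (imset_comp k h) leq_imset_card.
suff ->: g @: [set: T] = set0 by rewrite cards0.
by apply/setP => u; rewrite inE; apply/imsetP => -[x]; have := T0 x.
Qed.

(** The factor through which [g] depends on [h] maps one image onto the other, so the count makes it
    injective. *)
Lemma leq_card_image_inj :
  (forall x y, h x = h y -> g x = g y) ->
  #|h @: [set: T]| <= #|g @: [set: T]| ->
  forall x y, g x = g y -> h x = h y.
Proof.
move=> hg le_hg x y; have [k gk] := imset_factor x hg.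
have /imset_injP k_inj : #|k @: (h @: [set: T])| == #|h @: [set: T]|.
  by rewrite eqn_leq leq_imset_card -(imset_comp k h) -(eq_imset _ gk).
by rewrite !gk => /k_inj; apply; apply: imset_f.
Qed.

Lemma ltn_card_image x y :
  (forall x y, h x = h y -> g x = g y) -> g x = g y -> h x <> h y ->
  #|g @: [set: T]| < #|h @: [set: T]|.
Proof.
move=> hg gxy hxy; rewrite ltnNge; apply/negP => le_hg.
exact/hxy/(leq_card_image_inj hg le_hg).
Qed.

End ImageCounting.

(** The function obtained by renaming [w] to [v] factors through [g], and the renaming loses no
    value but [w]. *)
Lemma leq_card_image_merge (T U V : finType) (g : T -> U) (h : T -> V) v w :
  (forall x y, g x = g y ->
     (if h x == w then v else h x) = (if h y == w then v else h y)) ->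
  #|h @: [set: T]| <= #|g @: [set: T]|.+1.
Proof.
move=> /leq_card_image gh; set h' := fun x => if h x == w then v else h x.
have sub : h @: [set: T] \subset w |: h' @: [set: T].
  apply/subsetP => _ /imsetP[x _ ->]; rewrite !inE.
  case: eqVneq => //= hxw; apply/imsetP; exists x => //.
  by rewrite /h' (negPf hxw).
apply: leq_trans (subset_leq_card sub) _; rewrite cardsU1.
by apply: leq_trans (leq_add (leq_b1 _) gh) _; rewrite add1n.
Qed.

Lemma connect_invariant (T : finType) (U : Type) (r : rel T) (g : T -> U) :
  (forall x y, r x y -> g x = g y) -> forall x y, connect r x y -> g x = g y.
Proof.
move=> rg x y /connectP[p]; elim: p x => [|z p IHp] x /=; first by move=> _ ->.
by case/andP=> /rg-> /IHp.
Qed.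

Lemma odd_card_involutive (T : finType) (f : T -> T) (S : {set T}) :
  involutive f -> (forall x, f x != x) -> {in S, forall x, f x \in S} ->
  ~~ odd #|S|.
Proof.
move=> fK f_neq; have [n] := ubnP #|S|; elim: n S => // n IHn S le_Sn fS.
have [->|[x xS]] := set_0Vmem S; first by rewrite cards0.
have fxS : f x \in S :\ x by rewrite !inE f_neq fS.
have cardS : #|S| = #|S :\ x :\ f x|.+2.
  by rewrite (cardsD1 x S) xS (cardsD1 (f x)) fxS.
rewrite cardS /= negbK; apply: IHn => [|y].
  by move: le_Sn; rewrite cardS !ltnS => /ltnW.
rewrite !inE => /and3P[yfx yx yS]; rewrite fS // andbT (can_eq fK) yx /=.
by apply: contra yfx => /eqP <-; rewrite fK.
Qed.

Lemma card_alternating (T : finType) (f : T -> T) (o : pred T) (S : {set T}) :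
  involutive f -> (forall x, x \in S -> o (f x) = ~~ o x) ->
  {in S, forall x, f x \in S} ->
  #|[set x in S | o x]| = #|[set x in S | ~~ o x]|.
Proof.
move=> fK fo fS; rewrite -(card_imset _ (can_inj fK)); apply: eq_card => x.
rewrite !inE; apply/imsetP/andP => [[y]|[xS ox]].
  by rewrite inE => /andP[yS oy] ->; rewrite fS // fo // oy.
by exists (f x); rewrite ?fK // inE fS // fo.
Qed.

Lemma in_symdiff (E : finType) (A B : {set E}) e :
  (e \in symdiff A B) = (e \in A) (+) (e \in B).
Proof. by rewrite !inE; case: (e \in A); case: (e \in B). Qed.

(** * Faces of spanning ribbon subgraphs *)

Section Faces.

Variable E : finType.
Implicit Types (G : ribbon_graph E) (A B T : {set E}) (e : E) (x y : point E).

Definition turn B x : point E := if edge_of x \in B then side x else across x.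

Lemma acrossK : involutive (@across E).
Proof. by case=> a h; rewrite /across /= negbK. Qed.

Lemma sideK : involutive (@side E).
Proof. by case=> [[e b] h]; rewrite /side /= !negbK. Qed.

Lemma across_neq x : across x != x.
Proof. by case: x => [[e b] []]; rewrite /across !xpair_eqE andbF. Qed.

Lemma side_neq x : side x != x.
Proof. by case: x => [[e b] []]; rewrite /side !xpair_eqE andbF. Qed.

Lemma side_across x : side (across x) = across (side x).
Proof. by case: x => [[]]. Qed.

Lemma edge_across x : edge_of (across x) = edge_of x. Proof. by []. Qed.

Lemma edge_side x : edge_of (side x) = edge_of x. Proof. by []. Qed.

Lemma edge_turn B x : edge_of (turn B x) = edge_of x.
Proof. by rewrite /turn; case: ifP. Qed.

Lemma turnK B : involutive (turn B).
Proof.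
move=> x; rewrite /turn; case xB: (edge_of x \in B).
  by rewrite edge_side xB sideK.
by rewrite edge_across xB acrossK.
Qed.

Lemma turn_neq B x : turn B x != x.
Proof. by rewrite /turn; case: ifP; rewrite ?side_neq ?across_neq. Qed.

(** [across] and [side] generate a Klein four-group that acts simply transitively on the end points
    of the two arrows of an edge. *)
Lemma same_edge x y : edge_of x = edge_of y ->
  [\/ y = x, y = across x, y = side x | y = across (side x)].
Proof.
case: x y => [[e b] h] [[f c] i]; rewrite /edge_of /across /side /= => <-.
case: b; case: c; case: h; case: i; rewrite /=;
  first [apply: Or41; done|apply: Or42; done|apply: Or43; done|apply: Or44; done].
Qed.

Definition turn_rel G B : rel (point E) :=
  [rel x y | (y == link G x) || (y == turn B x)].

Definition face G B x : {set point E} := [set y | connect (turn_rel G B) x y].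

Definition faces G B : nat := #|face G B @: [set: point E]|.

Lemma turn_rel_sym G B : connect_sym (turn_rel G B).
Proof.
apply: sym_connect_sym => x y; rewrite /turn_rel /=; rewrite (eq_sym y) (eq_sym y (turn B x)).
by rewrite (can2_eq (@link_invol _ G) (@link_invol _ G)) (can2_eq (turnK B) (turnK B)).
Qed.

Lemma faceP G B x y : reflect (face G B x = face G B y) (y \in face G B x).
Proof.
rewrite inE; apply: (iffP idP) => [xy|xy].
  by apply/setP => z; rewrite !inE; apply: (same_connect (turn_rel_sym G B) xy).
by have := connect0 (turn_rel G B) y; move/setP: xy => /(_ y); rewrite !inE => ->.
Qed.

Lemma face_link G B x : face G B (link G x) = face G B x.
Proof. by apply/esym/faceP; rewrite inE connect1 // /turn_rel /= eqxx. Qed.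

Lemma face_turn G B x : face G B (turn B x) = face G B x.
Proof. by apply/esym/faceP; rewrite inE connect1 // /turn_rel /= eqxx orbT. Qed.

Lemma face_invariant G B (U : Type) (g : point E -> U) :
  (forall x, g (link G x) = g x) -> (forall x, g (turn B x) = g x) ->
  forall x y, face G B x = face G B y -> g x = g y.
Proof.
move=> gl gt x y /faceP; rewrite inE; apply: connect_invariant => u v.
by case/orP => /eqP->.
Qed.

Lemma face_partition G B :
  partition (face G B @: [set: point E]) [set: point E].
Proof.
have -> : face G B @: [set: point E] =
    equivalence_partition (connect (turn_rel G B)) [set: point E].
  by apply: eq_imset => x; apply/setP => y; rewrite !inE.
apply: equivalence_partitionP => x y z _ _ _; split; first exact: connect0.
by move/(same_connect (turn_rel_sym G B)) => ->.
Qed.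

End Faces.

(** * Toggling one edge *)

Section Toggle.

Variables (E : finType) (G : ribbon_graph E) (B B' : {set E}) (e : E).
Hypothesis toggle : forall f, (f \in B') = (f \in B) (+) (f == e).

Lemma turn_off x : edge_of x != e -> turn B' x = turn B x.
Proof. by move=> /negPf xe; rewrite /turn toggle xe addbF. Qed.

Lemma turn_on x : edge_of x = e -> turn B' x = if e \in B then across x else side x.
Proof. by move=> xe; rewrite /turn xe toggle eqxx addbT if_neg. Qed.

Lemma turn_turn x : edge_of x = e -> turn B (turn B' x) = turn B' (turn B x).
Proof.
move=> xe; rewrite (turn_on xe) (turn_on (x := turn B x)) ?edge_turn //.
by rewrite /turn xe; case eB: (e \in B); rewrite ?edge_across ?edge_side xe eB ?side_across.
Qed.

(** At [e], [turn B] and [turn B'] are [side] and [across] in some order; using only these two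
    treats the addition and the removal of [e] together. *)
Lemma same_edge_turn x y : edge_of x = e -> edge_of y = e ->
  [\/ y = x, y = turn B x, y = turn B' x | y = turn B (turn B' x)].
Proof.
move=> xe ye; rewrite (turn_on xe) /turn xe.
case: (same_edge (etrans xe (esym ye))) => ->; case eB: (e \in B);
  rewrite ?edge_across ?edge_side xe eB ?side_across.
all: first [apply: Or41; done|apply: Or42; done|apply: Or43; done|apply: Or44; done].
Qed.


(** At most two faces of [(G, B')] meet [e]. Once they are identified, all four end points of [e]
    have the same value, so the value is constant on the faces of [(G, B)]. *)
Lemma faces_toggle : faces G B' <= (faces G B).+1.
Proof.
pose x0 : point E := ((e, false), false).
pose v := face G B' x0; pose w := face G B' (turn B x0).
pose h x := if face G B' x == w then v else face G B' x.
apply: (leq_card_image_merge (v := v) (w := w)).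
change (forall x y, face G B x = face G B y -> h x = h y).
have he x : edge_of x = e -> h x = face G B' x0.
  move=> xe; rewrite /h /w; case: (same_edge_turn (erefl : edge_of x0 = e) xe) => ->;
  rewrite ?eqxx //; first by case: ifP.
    by rewrite face_turn; case: ifP.
  by rewrite turn_turn // face_turn eqxx.
apply: face_invariant => x; rewrite /h ?face_link //.
have [xe|xe] := eqVneq (edge_of x) e; last by rewrite -turn_off // face_turn.
by rewrite -/(h x) -/(h (turn B x)) !he // edge_turn.
Qed.

(** [turn B] pairs the four end points of [e] into two segments; whether both lie on one face does
    not depend on the end point chosen. *)
Lemma face_toggle_edge x y : edge_of x = e -> edge_of y = e ->
  face G B x = face G B (turn B' x) -> face G B y = face G B (turn B' y).
Proof.
move=> xe ye; case: (same_edge_turn xe ye) => -> // xx'.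
- by rewrite -turn_turn // !face_turn.
- by rewrite turnK.
by rewrite turn_turn // turnK -turn_turn // !face_turn.
Qed.

(* If the part K of the boundary of x that stays off the edge e missed
   [turn B x], then [link] would pair up the points of K, and [turn B] those of
   K other than x. *)
Lemma face_bridge x : edge_of x = e ->
  face G B x <> face G B (turn B' x) -> face G B' x = face G B' (turn B x).
Proof.
move=> xe xx'; pose r : rel (point E) :=
  [rel u v | (v == link G u) || (edge_of u != e) && (v == turn B u)].
have rB u v : connect r u v -> face G B u = face G B v.
  apply: connect_invariant => {}u {}v /orP[/eqP->|/andP[_ /eqP->]].
    by rewrite face_link.
  by rewrite face_turn.
have rB' u v : connect r u v -> face G B' u = face G B' v.
  apply: connect_invariant => {}u {}v /orP[/eqP->|/andP[ue /eqP->]].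
    by rewrite face_link.
  by rewrite -turn_off // face_turn.
pose K := [set y | connect r x y].
suff : turn B x \in K by rewrite inE => /rB'.
apply/negP => /negP x_K.
have evenK : ~~ odd #|K|.
  apply: (odd_card_involutive (@link_invol _ G) (@link_neq _ G)) => y.
  by rewrite !inE => /connect_trans; apply; rewrite connect1 // /r /= eqxx.
have xK : x \in K by rewrite inE.
move: evenK; rewrite (cardsD1 x) xK /= negbK; apply/negP.
apply: (odd_card_involutive (turnK B) (turn_neq B)) => y.
rewrite !inE => /andP[yx Ky].
have ye : edge_of y != e.
  (* Among the end points of [e], [x] and [turn B x] are excluded by assumption, and the other two
     lie on another face of [(G, B)]. *)
  apply/eqP => ye; have [] := same_edge_turn xe ye => yE; move: yx x_K Ky.
  - by rewrite yE eqxx.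
  - by rewrite yE inE => _ /negP.
  - by rewrite yE => _ _ /rB.
  by rewrite yE => _ _ /rB; rewrite face_turn.
apply/andP; split; first by apply: contra ye => /eqP tyx; rewrite -(edge_turn B y) tyx xe.
by apply: (connect_trans Ky); rewrite connect1 // /r /= ye eqxx orbT.
Qed.

(** By [face_bridge], points joined by [turn B] at [e] stay joined in [(G, B')], whose faces are
    therefore unions of faces of [(G, B)]. *)
Lemma face_toggle_sub x : edge_of x = e -> face G B x <> face G B (turn B' x) ->
  forall u v, face G B u = face G B v -> face G B' u = face G B' v.
Proof.
move=> xe xx'; apply: face_invariant => u; first by rewrite face_link.
have [ue|ue] := eqVneq (edge_of u) e; last by rewrite -turn_off // face_turn.
rewrite -face_bridge // => uu'; exact/xx'/(face_toggle_edge ue xe uu').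
Qed.

Lemma faces_toggle_lt x : edge_of x = e -> face G B x <> face G B (turn B' x) ->
  faces G B' < faces G B.
Proof.
move=> xe xx'; apply: ltn_card_image (face_toggle_sub xe xx') _ xx'.
by rewrite face_turn.
Qed.

(** Otherwise [face G B] would be constant on the faces of [(G, B')], which would then be at least
    as many. *)
Lemma face_toggle_join x : faces G B' < faces G B -> edge_of x = e ->
  face G B x <> face G B (turn B' x).
Proof.
move=> ltB xe xx'; move: ltB; rewrite ltnNge => /negP; apply.
apply: leq_card_image; apply: face_invariant => u; first by rewrite face_link.
have [ue|ue] := eqVneq (edge_of u) e; last by rewrite turn_off // face_turn.
by rewrite -(face_toggle_edge xe ue xx').
Qed.

End Toggle.

(** * Face counts and existence of spanning quasi-trees *)

Section FaceCounts.

Variables (E : finType) (G : ribbon_graph E).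
Implicit Types (A B T Q : {set E}) (e : E) (x y : point E).

Lemma faces_gt0 B x : 0 < faces G B.
Proof. by apply/card_gt0P; exists (face G B x); apply: imset_f. Qed.

Lemma faces_le1 B : faces G B <= 1 -> forall x y, face G B x = face G B y.
Proof. by move=> /card_le1_eqP f1 x y; apply: f1; apply: imset_f. Qed.

Lemma face_const_le1 B : (forall x y, face G B x = face G B y) -> faces G B <= 1.
Proof.
by move=> f1; apply/card_le1_eqP => _ _ /imsetP[x _ ->] /imsetP[y _ ->].
Qed.

Lemma faces_subset T T' : T \subset T' -> faces G T' <= faces G T + #|T' :\: T|.
Proof.
have [n] := ubnP #|T' :\: T|; elim: n T => // n IHn T le_n sTT'.
have [D0|[e]] := set_0Vmem (T' :\: T).
  have -> : T' = T by apply/eqP; rewrite eqEsubset -setD_eq0 D0 eqxx.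
  exact: leq_addr.
rewrite inE => /andP[eT eT'].
have sT1 : e |: T \subset T' by rewrite subUset sub1set eT'.
have cardD : #|T' :\: T| = #|T' :\: (e |: T)|.+1.
  by rewrite (cardsD1 e) inE eT eT' setUC -setDDl.
rewrite cardD ltnS in le_n; apply: leq_trans (IHn _ le_n sT1) _.
rewrite cardD addnS -addSn leq_add2r; apply: (@faces_toggle _ _ _ _ e) => f.
by rewrite !inE; case: eqVneq => [->|]; rewrite ?(negPf eT) //= addbF.
Qed.

(** Connectedness, tested on invariant functions; the values are sets of points because it is
    applied to [face G A]. *)
Hypothesis G_conn : forall g : point E -> {set point E},
  (forall x, g (link G x) = g x) -> (forall x, g (across x) = g x) ->
  (forall x, g (side x) = g x) -> forall x y, g x = g y.

(** Edges whose two segments lie on different faces are toggled while there are any, each toggle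
    lowering the number of faces. [T] collects the edges toggled an odd number of times. *)
Lemma exists_quasi_tree x0 A : exists2 T : {set E},
  #|T| < faces G A & faces G (symdiff A T) = 1.
Proof.
suff span n : faces G A <= n.+1 -> exists2 T : {set E},
    #|T| <= n & faces G (symdiff A T) = 1.
  have := faces_gt0 A x0; case: (faces G A) span => // n span _.
  by have [T] := span n (leqnn _); exists T.
elim: n A => [|n IHn] A le_n.
  exists set0; rewrite ?cards0 //; apply/eqP; rewrite eqn_leq (faces_gt0 _ x0).
  suff -> : symdiff A set0 = A by rewrite le_n.
  by apply/setP => e; rewrite in_symdiff inE addbF.
pose A' x := symdiff A [set edge_of x].
have toggleA x f : (f \in A' x) = (f \in A) (+) (f == edge_of x).
  by rewrite in_symdiff inE.
case: (pickP (fun x => face G A x != face G A (turn (A' x) x))) => [x /eqP xx'|same].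
  have := faces_toggle_lt (toggleA x) erefl xx' => /leq_trans/(_ le_n).
  rewrite ltnS => /IHn[T le_T faces1]; exists (symdiff T [set edge_of x]).
    have sT : symdiff T [set edge_of x] \subset edge_of x |: T.
      by apply/subsetP => f; rewrite in_symdiff !inE orbC; case: (f \in T).
    by apply: leq_trans (subset_leq_card sT) _; rewrite cardsU1 -add1n leq_add ?leq_b1.
  rewrite -faces1; congr faces; apply/setP => f.
  by rewrite !in_symdiff addbA addbAC.
(* No edge separates two faces: [face G A] is then invariant under [across] and [side] too, and
   connectedness leaves one face. *)
exists set0; rewrite ?cards0 //; apply/eqP; rewrite eqn_leq (faces_gt0 _ x0) andbT.
have -> : symdiff A set0 = A by apply/setP => e; rewrite in_symdiff inE addbF.
apply/face_const_le1/G_conn => [x|x|x]; first exact: face_link.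
  have /eqP := negbFE (same x); have := face_turn G A x.
  by rewrite (turn_on (toggleA x)) // /turn; case: (_ \in A) => [_ ->|-> _].
have /eqP := negbFE (same x); have := face_turn G A x.
by rewrite (turn_on (toggleA x)) // /turn; case: (_ \in A) => [-> _|_ ->].
Qed.

End FaceCounts.

(** * Partial duality *)

Section Duality.

Variables (E : finType) (G : ribbon_graph E) (Q : {set E}).
Implicit Types (B : {set E}) (x y : point E).
Let H := partial_dual G Q.

Lemma old_point_link x : old_point Q (link H x) = link G (old_point Q x).
Proof. exact: new_pointK. Qed.

(** At an edge of [Q], the new arrows run along the old free sides and the new free sides along the
    old arrows, so duality exchanges [across] and [side]. *)
Lemma old_point_turn B x :
  old_point Q (turn B x) = turn (symdiff Q B) (old_point Q x).
Proof.
case: x => [[e b] h]; rewrite /turn /old_point /edge_of.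
case eQ: (e \in Q); case eB: (e \in B); case: h => /=;
  by rewrite ?in_symdiff /= ?eQ ?eB /= ?eQ ?eB /= /side /across /= ?negbK.
Qed.

Lemma mem_face_dual B x y :
  (old_point Q y \in face G (symdiff Q B) (old_point Q x)) = (y \in face H B x).
Proof.
apply/faceP/faceP => [|].
  move=> /(face_invariant (g := face H B \o new_point Q)) /=.
  rewrite !old_pointK; apply => z; rewrite -[z](new_pointK Q) ?old_pointK.
    by rewrite -old_point_link !old_pointK face_link.
  by rewrite -old_point_turn !old_pointK face_turn.
move=> /(face_invariant (g := face G (symdiff Q B) \o old_point Q)) /=.
by apply => z; rewrite ?old_point_link ?face_link // old_point_turn face_turn.
Qed.

Lemma card_face_dual B x :
  #|face H B x| = #|face G (symdiff Q B) (old_point Q x)|.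
Proof.
rewrite -[RHS](card_preimset _ (can_inj (old_pointK Q))); apply: eq_card => y.
by rewrite [RHS]inE mem_face_dual.
Qed.

Lemma faces_dual B : faces H B = faces G (symdiff Q B).
Proof.
have -> : faces G (symdiff Q B) =
    #|(fun x => face G (symdiff Q B) (old_point Q x)) @: [set: point E]|.
  rewrite (imset_comp (face G (symdiff Q B)) (old_point Q)).
  suff -> : old_point Q @: [set: point E] = [set: point E] by [].
  by apply/setP => x; rewrite inE -[x](new_pointK Q) imset_f.
by apply/eqP; rewrite eqn_leq; apply/andP; split; apply: leq_card_image => x y;
  move=> /faceP; rewrite ?mem_face_dual => xy; apply/faceP; rewrite ?mem_face_dual.
Qed.

End Duality.

(** * Vertices and degrees in terms of faces *)

Section Components.

Variables (E : finType) (G : ribbon_graph E).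
Implicit Types (B Q : {set E}) (x : point E).

Lemma size_components (r : rel (point E)) :
  size (components G r) =
    #|(fun x => [set y | connect r x y]) @: [set: point E]| + isolated G.
Proof.
rewrite size_cat size_nseq -cardE; congr (#|pred_of_set _| + _).
by apply: eq_imset => x; apply/setP => y; rewrite !inE.
Qed.

Lemma mem_vertices v : (v \in vertices G) =
  (v \in face G set0 @: [set: point E]) || (v == set0) && (0 < isolated G).
Proof.
rewrite mem_cat mem_enum mem_nseq andbC; congr ((v \in pred_of_set _) || _).
apply: eq_imset => x; apply/setP => y; rewrite !inE; apply: eq_connect => u w.
by rewrite /turn_rel /turn /= inE.
Qed.

Lemma card_degree B x : B = set0 -> #|face G B x| = (degree (face G B x)).*2.
Proof.
move=> ->; set v := face _ _ _.
have v_across y : (across y \in v) = (y \in v).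
  apply/faceP/faceP => ->; first by rewrite -(face_turn _ _ y) /turn inE.
  by rewrite -{1}(acrossK y) -(face_turn _ _ (across y)) /turn inE.
rewrite /degree -addnn.
pose tail h a : point E := (a, h).
have tail_inj h : injective (tail h) by move=> a b [].
rewrite -{1}(card_imset _ (@tail_inj false)) -(card_imset _ (@tail_inj true)).
rewrite -cardsUI.
set A0 := _ @: _; set A1 := _ @: _; have -> : A0 :&: A1 = set0.
  apply/setP => y; rewrite !inE; apply/andP => -[/imsetP[a _ ->] /imsetP[b _]].
  by case.
rewrite cards0 addn0; apply: eq_card => -[a h]; rewrite in_setU; apply/idP/orP.
  case: h => av; [right|left]; apply/imsetP; exists a => //; rewrite inE //.
  by rewrite -v_across.
case=> /imsetP[b]; rewrite inE => bv [-> ->] //.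
by rewrite -v_across.
Qed.

End Components.

(** * Cyclic readings of a bouquet *)

Lemma uniq_map_inj_in (T U : eqType) (f : T -> U) (s : seq T) :
  uniq (map f s) -> {in s &, injective f}.
Proof.
elim: s => //= z s IHs /andP[fz /IHs inj_s] x y; rewrite !inE.
case/predU1P => [->|xs] /predU1P[->|ys] // fxy; last exact: inj_s.
  by case/negP: fz; rewrite fxy map_f.
by case/negP: fz; rewrite -fxy map_f.
Qed.

Lemma fpath_image (T : eqType) (f : T -> T) x p y a :
  fpath f x (rcons p y) -> a \in x :: p -> f a \in rcons p y.
Proof.
elim: p x => [|z p IHp] x /=; first by rewrite andbT !inE => /eqP<- /eqP->.
case/andP=> /eqP<- fp; rewrite inE => /predU1P[->|/(IHp _ fp)].
  by rewrite mem_head.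
by rewrite inE orbC => ->.
Qed.

(** Rotated to start at [x], the cycle is the arc up to [y] followed by the arc from [y]; a step
    changes arcs only by landing on [x] or [y]. *)
Lemma mem_arc_succ (T : eqType) (f : T -> T) (c : seq T) x y :
  fcycle f c -> uniq c -> x \in c -> y \in c -> x != y ->
  [/\ x \in arc c x y, y \notin arc c x y
    & forall a, a \in c ->
        (a \in arc c x y) = (f a \in arc c x y) (+) (f a \in [:: x; y])].
Proof.
move=> f_c Uc cx cy xy; have [i p1 p2 <- _ ip] := rot_to_arc Uc cx cy xy.
move: f_c Uc; rewrite -(rot_cycle i) -(rot_uniq i) ip /= rcons_cat cat_path /=.
rewrite mem_cat inE cat_uniq /= negb_or => /and3P[f1 fy f2].
case/and5P => /andP[xp1 /norP[_ xp2]] p1_uniq /norP[yp1 p12] yp2 _.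
rewrite mem_head; split=> // [|a].
  by rewrite inE negb_or eq_sym xy.
rewrite -(mem_rot i) ip -cat_cons mem_cat.
have f1y : fpath f x (rcons p1 y) by rewrite rcons_path f1.
have [ap1 _|ap1 /= ap2] := boolP (a \in x :: p1).
  have := fpath_image f1y ap1; rewrite mem_rcons !inE => /predU1P[->|fa].
    by rewrite eqxx eq_sym (negPf xy) (negPf yp1).
  have /negPf-> : f a != x by apply: contra xp1 => /eqP<-.
  have /negPf-> : f a != y by apply: contra yp1 => /eqP<-.
  by rewrite fa.
have := fpath_image f2 ap2; rewrite mem_rcons !inE => /predU1P[->|fa].
  by rewrite eqxx.
have /negPf-> : f a != x by apply: contra xp2 => /eqP<-.
have /negPf-> : f a != y by apply: contra yp2 => /eqP<-.
by apply/esym/negbTE; rewrite addbF /=; apply: contra p12 => fa1; apply/hasP; exists (f a).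
Qed.

Lemma arc_complement (T : eqType) (c : seq T) x y a :
  uniq c -> x \in c -> y \in c -> x != y -> a \in c ->
  (a \in arc c y x) = (a \notin arc c x y).
Proof.
move=> Uc cx cy xy; have [i p1 p2 <- <- ip] := rot_to_arc Uc cx cy xy.
rewrite -(mem_rot i) -(rot_uniq i) ip -cat_cons mem_cat cat_uniq in Uc *.
case/and3P: Uc => _ p12 _; case: (boolP (a \in x :: p1)) => //= ap1 _.
by apply/negbTE/negP => ap2; case/negP: p12; apply/hasP; exists a.
Qed.

Section Reading.

Variables (E : finType) (H : ribbon_graph E) (p : seq (point E)).
Hypothesis p_cycle : fcycle (link H \o @across E) p.
Hypothesis p_uniq : uniq [seq x.1 | x <- p].
Hypothesis p_all : forall a : arrow E, a \in [seq x.1 | x <- p].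

Implicit Types (e f : E) (x y : point E) (a : arrow E) (b : bool).

Let s := [seq x.1 | x <- p].

(** Each arrow is entered at exactly one of its two ends: [p] is the set of entries and its
    complement the set of exits. *)
Lemma reading_across x : (across x \in p) = (x \notin p).
Proof.
have acr_out y : y \in p -> across y \notin p.
  move=> yp; apply/negP => ayp.
  have := across_neq y; rewrite (uniq_map_inj_in p_uniq ayp yp) ?eqxx //.
have [xp|xp] := boolP (x \in p); first exact/negbTE/acr_out.
have /mapP[y yp xy] := p_all x.1; suff -> : across x = y by [].
have [] := same_edge (x := x) (y := y); first by rewrite /edge_of xy.
- by move=> yx; rewrite yx (negPf xp) in yp.
- by move->.
- by move=> yE; move: xy; rewrite yE; case: (x) => [[e []] h].
by move=> yE; move: xy; rewrite yE; case: (x) => [[e []] h].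
Qed.

Lemma reading_link x : (link H x \in p) = (x \notin p).
Proof.
have in_p y : y \in p -> link H (across y) \in p.
  move=> yp; have /eqP := next_cycle p_cycle yp; rewrite /= => ->.
  by rewrite mem_next.
have pre_p y : y \in p -> across (link H y) \in p.
  move=> yp; have /eqP /= <- := prev_cycle p_cycle yp.
  by rewrite link_invol acrossK mem_prev.
have [xp|xp] := boolP (x \in p).
  by apply/negbTE; rewrite -reading_across pre_p.
by rewrite -[x]acrossK in_p // reading_across.
Qed.

(* [link] pairs the points up into the arcs of the circle between consecutive
   arrows; each of these arcs is named after the arrow at which it starts. *)
Definition arc_start x : arrow E := (if x \in p then link H x else x).1.

Definition exit_point a : point E := (a, (a, true) \notin p).

Lemma exit_pointN a : exit_point a \notin p.
Proof.
rewrite /exit_point; have [ap|//] := boolP ((a, true) \in p).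
by have := reading_across (a, true); rewrite ap => /negbT.
Qed.

Lemma exit_pointE x : x \notin p -> exit_point x.1 = x.
Proof.
case: x => a h /= xp; rewrite /exit_point; congr (_, _).
have := reading_across (a, true).
by case: h xp => /= [->|/negPf xp] //; rewrite /across /= xp => <-.
Qed.

Lemma arc_start_exit a : arc_start (exit_point a) = a.
Proof. by rewrite /arc_start (negPf (exit_pointN a)). Qed.

Lemma arc_start_link x : arc_start (link H x) = arc_start x.
Proof.
by rewrite /arc_start reading_link link_invol; case: (x \in p).
Qed.

Definition succ_arrow a : arrow E := (link H (exit_point a)).1.

Lemma succ_arrow_cycle : fcycle succ_arrow s.
Proof.
rewrite /s (cycle_map (f := fst)).
apply: (sub_in_cycle (P := mem p)) p_cycle; last exact/allP.
move=> x y xp _ /= /eqP<-; rewrite /succ_arrow; apply/eqP; congr (link H _).1.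
by rewrite -(exit_pointE (x := across x)) // reading_across negbK.
Qed.

Lemma succ_arc_start x : x \notin p -> succ_arrow (arc_start (across x)) = x.1.
Proof.
move=> xp; rewrite /arc_start reading_across xp /succ_arrow exit_pointE.
  by rewrite link_invol.
by rewrite reading_link reading_across negbK.
Qed.

(** Each circle arc has two ends, the exit of the arrow where it starts and the [link] of that
    exit. *)
Lemma card_arc_start (F : {set arrow E}) :
  #|[set x | arc_start x \in F]| = #|F|.*2.
Proof.
have exit_inj : injective exit_point by move=> a b /(congr1 fst).
have link_inj : injective (link H) := can_inj (@link_invol _ H).
rewrite -addnn -{1}(card_imset _ exit_inj) -(card_imset _ (inj_comp link_inj exit_inj)).
rewrite -cardsUI.
set A0 := _ @: _; set A1 := _ @: _; have -> : A0 :&: A1 = set0.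
  apply/setP => y; rewrite inE in_set0; apply/andP => -[/imsetP[a _ ->] /imsetP[b _]].
  by move=> ab; have := exit_pointN a; rewrite ab /= reading_link exit_pointN.
rewrite cards0 addn0; apply: eq_card => x; rewrite in_set in_setU.
apply/idP/orP => [xF|[]/imsetP[a aF ->]]; last first.
- by rewrite /= arc_start_link arc_start_exit.
- by rewrite arc_start_exit.
move: xF; rewrite /arc_start; case: ifP => xp xF; [right|left].
  apply/imsetP; exists (link H x).1 => //=.
  by rewrite exit_pointE ?link_invol // reading_link xp.
by apply/imsetP; exists x.1; rewrite ?exit_pointE ?xp.
Qed.

Section Arc.

Variables (e : E) (b : bool).
Let C := arrow_arc s e b.

Let arc_spec : [/\ (e, b) \in C, (e, ~~ b) \notin C
    & forall a, (a \in C) = (succ_arrow a \in C) (+) ((succ_arrow a).1 == e)].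
Proof.
have ee : (e, b) != (e, ~~ b) by rewrite xpair_eqE eqxx; case: b.
have [C1 C2 C3] := mem_arc_succ succ_arrow_cycle p_uniq (p_all (e, b)) (p_all (e, ~~ b)) ee.
split; rewrite ?inE // => a; rewrite !inE C3 ?p_all //; congr (_ (+) _).
by case: (succ_arrow a) => f c; rewrite !inE !xpair_eqE -andb_orr; case: b; case: c;
  rewrite ?andbT.
Qed.

Lemma arrow_arcC : arrow_arc s e (~~ b) = ~: C.
Proof.
apply/setP => a; rewrite !inE negbK; apply: arc_complement; rewrite ?p_all //.
by rewrite xpair_eqE eqxx; case: b.
Qed.

(** [across] goes between the circle arcs before and after an arrow, and [C] begins and ends at the
    arrows of [e]. *)
Lemma arc_start_across x :
  (arc_start (across x) \in C) = (arc_start x \in C) (+) (edge_of x == e).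
Proof.
have [_ _ C3] := arc_spec.
wlog xp : x / x \notin p => [hw|].
  have [xp|/hw//] := boolP (x \in p).
  have := hw (across x); rewrite acrossK reading_across negbK edge_across.
  by move=> -> //; rewrite addbK.
by rewrite C3 succ_arc_start // /arc_start (negPf xp).
Qed.

(** A free side of such an edge joins the exit of one arrow of [e] to the entry of the other; the
    circle arcs at these two places lie both in [C] or both outside it. *)
Lemma arc_start_side x : edge_of x = e -> (side x \in p) = (x \notin p) ->
  (arc_start (side x) \in C) = (arc_start x \in C).
Proof.
have [C1 C2 _] := arc_spec.
wlog xp : x / x \notin p => [hw xe sx|xe sx].
  have [xp|/hw->//] := boolP (x \in p).
  rewrite -{2}[x]sideK; apply/esym/hw; rewrite ?edge_side ?sideK ?sx ?xp //.
have sxp : across (side x) \notin p by rewrite reading_across negbK sx.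
have := arc_start_across (across (side x)); rewrite acrossK => ->.
rewrite edge_across edge_side xe eqxx addbT /arc_start (negPf xp) (negPf sxp).
case: x xe {sx sxp xp} => [[f c] h]; rewrite /edge_of /= => ->.
by case: (b) (c) C1 C2 => [] [] /= -> // /negPf->.
Qed.

End Arc.

(** The entries [p] orient the circle, and a bouquet has no orientation of its circle besides this
    one and its reverse. *)
Lemma orientable_loopP e : (forall x y, face H set0 x = face H set0 y) ->
  (orientable_loop H e <->
   forall x, edge_of x = e -> (side x \in p) = (x \notin p)).
Proof.
move=> H_conn; split=> [[o [oa ol oe]] x xe|p_e]; last first.
  exists (fun x => x \in p); split=> [x|x|f]; rewrite ?reading_across ?reading_link //.
  rewrite inE => /eqP->; have := p_e ((e, false), true) erefl; rewrite /side /= => ->.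
  by rewrite -reading_across.
have o_side : o (side x) = ~~ o x.
  have oe' := oe e (set11 e).
  case: x xe => [[f c] h]; rewrite /edge_of /= => ->; rewrite /side /=.
  have oat c' : o ((e, c'), true) = ~~ o ((e, c'), false) by rewrite -oa.
  by case: c; case: h; rewrite /= ?oat ?negbK ?oe' ?oat ?negbK.
(* The sum of [o] and membership in [p] is unchanged by [link] and [across], hence constant on the
   single circle. *)
have o_p : o (side x) (+) (side x \in p) = o x (+) (x \in p).
  apply: (face_invariant (g := fun y => o y (+) (y \in p)) _ _ (H_conn _ _)) => y.
    by rewrite ol reading_link addNb addbN negbK.
  by rewrite /turn inE oa reading_across addNb addbN negbK.
by move: o_p; rewrite o_side; case: (o x); case: (x \in p); case: (side x \in p).
Qed.

End Reading.

(** * Nested sequences of a bouquet *)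

Section Regions.

Variables (E : finType) (H : ribbon_graph E) (p : seq (point E)).
Variable D : E -> {set arrow E}.
Hypothesis p_cycle : fcycle (link H \o @across E) p.
Hypothesis p_uniq : uniq [seq x.1 | x <- p].
Hypothesis p_all : forall a : arrow E, a \in [seq x.1 | x <- p].
Hypothesis H_conn : forall x y, face H set0 x = face H set0 y.
Hypothesis D_arc : forall e, exists b, D e = arrow_arc [seq x.1 | x <- p] e b.

Implicit Types (e f : E) (x y : point E) (T : {set E}).

Definition inside e x : bool := arc_start H p x \in D e.

(** Orientability of the loop [e], by [orientable_loopP]. *)
Definition two_sided e := forall x, edge_of x = e -> (side x \in p) = (x \notin p).

Definition nested_or_disjoint e f :=
  [|| D e \subset D f, D f \subset D e | [disjoint D e & D f]].

(** Non-interlacing as a boundary walk sees it: no free side of [f] leads into or out of [D e]. *)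
Definition uncrossed e f := forall x, edge_of x = f -> inside e (side x) = inside e x.

Lemma inside_link e x : inside e (link H x) = inside e x.
Proof. by rewrite /inside arc_start_link. Qed.

Lemma inside_across e x : inside e (across x) = inside e x (+) (edge_of x == e).
Proof. by have [b De] := D_arc e; rewrite /inside De arc_start_across. Qed.

Lemma inside_side e x : two_sided e -> edge_of x = e -> inside e (side x) = inside e x.
Proof.
move=> te xe; have [b De] := D_arc e.
by rewrite /inside De arc_start_side // te.
Qed.

Lemma inside_sub e f x : D e \subset D f -> inside e x -> inside f x.
Proof. by move=> /subsetP; apply. Qed.

Lemma inside_disjoint e f x : [disjoint D e & D f] -> inside e x -> ~~ inside f x.
Proof. by move=> ef xe; rewrite /inside (disjointFr ef xe). Qed.

Lemma inside_edge e c : exists2 x, edge_of x = e & inside e x = c.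
Proof.
pose x : point E := ((e, false), false).
have [xc|xc] := eqVneq (inside e x) c; first by exists x.
by exists (across x); rewrite // inside_across eqxx; case: (inside e x) c xc => [] [].
Qed.

(** Passing an arrow changes membership in [D e] exactly at the arrows of [e], so [D e] determines
    [e]. *)
Lemma sequence_inj : injective D.
Proof.
move=> e f Def; apply/eqP/negPn/negP => ef.
have [x xe _] := inside_edge e true; have := inside_across f x.
have := inside_across e x; rewrite xe (negPf ef) eqxx /inside Def => ->.
by case: (_ \in _).
Qed.

(** Take both ends of a free side of [f] inside [D f]. They are inside [D e] if it contains [D f],
    outside if it is disjoint from [D f]; if [D e] lies in [D f], [across] moves both out of [D f],
    hence out of [D e], without changing their position relative to [D e]. *)
Lemma nested_uncrossed e f :
  e != f -> two_sided f -> nested_or_disjoint e f -> uncrossed e f.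
Proof.
move=> ef tf ND; have off x : edge_of x = f -> inside e (across x) = inside e x.
  by move=> xf; rewrite inside_across xf eq_sym (negPf ef) addbF.
have flip x : edge_of x = f -> inside f (across x) = ~~ inside f x.
  by move=> xf; rewrite inside_across xf eqxx addbT.
move=> x xf; wlog xin : x xf / inside f x => [hw|].
  have [xin|xout] := boolP (inside f x); first exact: hw.
  by have := hw (across x); rewrite side_across !off ?edge_side // flip // xout; apply.
have sxin : inside f (side x) by rewrite inside_side.
case/or3P: ND => ND; last 2 first.
- by rewrite !(inside_sub ND).
- rewrite disjoint_sym in ND.
  by rewrite (negPf (inside_disjoint ND xin)) (negPf (inside_disjoint ND sxin)).
rewrite -off ?edge_side // -[RHS]off //.
have out y : edge_of y = f -> inside f y -> inside e (across y) = false.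
  by move=> yf yin; apply: contraTF yin => /(inside_sub ND); rewrite flip.
by rewrite !out.
Qed.

Definition region T x : {set E} := [set e in T | inside e x].

(** At an edge of [T] the walk follows a free side, which crosses no sequence of [T]; at any other
    edge it crosses only the sequence of that edge. *)
Lemma face_region T :
  {in T, forall e, two_sided e} -> {in T &, forall e f, e != f -> uncrossed e f} ->
  forall x y, face H T x = face H T y -> region T x = region T y.
Proof.
move=> T_two T_un; apply: face_invariant => x; apply/setP => e; rewrite !inE.
  by rewrite inside_link.
have [eT|//] := boolP (e \in T); rewrite /= /turn; case: ifP => xT.
  have [xe|xe] := eqVneq (edge_of x) e; first by rewrite inside_side //; apply: T_two.
  by rewrite (T_un e (edge_of x)) // eq_sym.
by rewrite inside_across; case: eqVneq xT => [->|]; rewrite ?eT ?addbF.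
Qed.

Lemma faces_le T : faces H T <= #|T|.+1.
Proof.
apply: leq_trans (faces_subset H (sub0set T)) _; rewrite setD0 -add1n leq_add2r.
exact: face_const_le1.
Qed.

(** * Regions of a nested or disjoint family *)

Section Laminar.

Variable T : {set E}.
Hypothesis T_two : {in T, forall e, two_sided e}.
Hypothesis T_nested : {in T &, forall e f, nested_or_disjoint e f}.

(** The region of the innermost part of [D e]. *)
Definition above e : {set E} := [set f in T | D e \subset D f].

Lemma above_inj : {in T &, injective above}.
Proof.
move=> e f eT fT /setP ef; apply/sequence_inj/eqP; rewrite eqEsubset.
have := ef f; have := ef e; rewrite !inE eT fT !subxx /= => <- ->.
by [].
Qed.

(** A sequence meeting [D e] contains it or lies in it, and the right-hand set, the one counted by
    [seq_length], excludes the proper subsequences. *)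
Lemma region_above e x : e \in T -> 
  (region T x == above e) = (arc_start H p x \in
     D e :\: \bigcup_(C in D @: T | C \proper D e) C).
Proof.
move=> eT; rewrite inE; apply/eqP/andP => [/setP Rx|[small xe]].
  have xe : inside e x by have := Rx e; rewrite !inE eT subxx.
  split=> //; apply/bigcupP => -[_ /andP[/imsetP[f fT ->] fe] xf].
  have := Rx f; rewrite !inE fT /= /inside xf => /esym ef.
  by have := proper_sub_trans fe ef; rewrite properxx.
apply/setP => f; rewrite !inE; have [fT|//] := boolP (f \in T); rewrite /=.
apply/idP/idP => [xf|/inside_sub]; last exact.
case/or3P: (T_nested eT fT) => // ND.
  have [//|fe] := boolP (D e \subset D f); case/negP: small.
  apply/bigcupP; exists (D f); last exact: xf.
  by rewrite imset_f //= properE ND fe.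
by have := inside_disjoint ND xe; rewrite xf.
Qed.

(** The witness is an end, inside [D e], of an arrow of [e]: there [across] leaves [D e] and no
    other sequence, so no other [D f] within [D e] contains it. *)
Lemma above_region e : e \in T -> exists x, region T x = above e.
Proof.
move=> eT; have [x xe xin] := inside_edge e true.
exists x; apply/setP => f; rewrite !inE; have [fT|//] := boolP (f \in T); rewrite /=.
apply/idP/idP => [xf|/inside_sub]; last exact.
have [<-//|ef] := eqVneq e f.
have axf : inside f (across x) by rewrite inside_across xe (negPf ef) xf.
have axe : ~~ inside e (across x) by rewrite inside_across xe eqxx xin.
case/or3P: (T_nested eT fT) => // ND.
  by rewrite (inside_sub ND axf) in axe.
by have := inside_disjoint ND xin; rewrite xf.
Qed.

(** The witness lies just outside a longest [D e], at an arrow of [e]: a sequence containing it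
    would also meet [D e], hence contain it properly and be longer. [x0] serves when [T] is
    empty. *)
Lemma region0 x0 : exists x, region T x = set0.
Proof.
have [->|[e1 e1T]] := set_0Vmem T.
  by exists x0; apply/setP => e; rewrite !inE.
have [e eT e_max] := arg_maxnP (fun e => #|D e|) e1T.
have [x xe xout] := inside_edge e false.
exists x; apply/setP => f; rewrite !inE; apply/negP => /andP[fT xf].
have ef : e != f by apply: contraFneq xout => ->.
have axf : inside f (across x) by rewrite inside_across xe (negPf ef) xf.
have axe : inside e (across x) by rewrite inside_across xe eqxx xout.
case/or3P: (T_nested eT fT) => ND.
- suff /proper_card : D e \proper D f by rewrite ltnNge => /negP[]; apply: e_max.
  by rewrite properE ND; apply/negP => /inside_sub/(_ xf); rewrite xout.
- by rewrite (inside_sub ND xf) in xout.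
by have := inside_disjoint ND axe; rewrite axf.
Qed.

(** At least [#|T|.+1] regions occur, regions are no more numerous than faces, and there are at most
    [#|T|.+1] faces; so equality holds throughout. *)
Lemma laminar_faces x0 :
  [/\ faces H T = #|T|.+1,
      forall x, region T x = set0 \/ exists2 e, e \in T & region T x = above e
    & forall x y, region T x = region T y -> face H T x = face H T y].
Proof.
pose V := set0 |: above @: T.
have sub : V \subset region T @: [set: point E].
  apply/subsetP => _ /setU1P[->|/imsetP[e eT ->]].
    by have [x <-] := region0 x0; apply: imset_f.
  by have [x <-] := above_region eT; apply: imset_f.
have cardV : #|V| = #|T|.+1.
  rewrite cardsU1 (card_in_imset above_inj) (_ : set0 \notin _) //.
  apply/imsetP => -[e eT /setP/(_ e)]; by rewrite !inE eT subxx.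
have fr := face_region T_two (fun e f eT fT ef =>
  nested_uncrossed ef (T_two fT) (T_nested eT fT)).
have le1 := subset_leq_card sub; have le2 := leq_card_image fr.
have le3 := faces_le T; rewrite cardV in le1.
have eqF : faces H T = #|T|.+1.
  by apply/eqP; rewrite eqn_leq le3 (leq_trans le1 le2).
split=> // [x|]; last first.
  by apply: leq_card_image_inj fr _; rewrite -/(faces H T) eqF.
have /eqP eqV : V == region T @: [set: point E].
  by rewrite eqEcard sub cardV (leq_trans le2).
have : region T x \in V by rewrite eqV imset_f.
by case/setU1P => [|/imsetP[e]]; [left|right; exists e].
Qed.

Lemma card_face_region x0 x : #|face H T x| = #|[set y | region T y == region T x]|.
Proof.
have [_ _ rf] := laminar_faces x0.
have fr := face_region T_two (fun e f eT fT ef =>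
  nested_uncrossed ef (T_two fT) (T_nested eT fT)).
apply: eq_card => y; rewrite [RHS]inE; apply/faceP/eqP => [/fr->|/rf] //.
Qed.

Lemma card_above e : e \in T ->
  #|[set y | region T y == above e]| = (seq_length (D @: T) (D e)).*2.
Proof.
move=> eT; rewrite -(card_arc_start p_cycle p_uniq p_all); apply: eq_card => y.
by rewrite [LHS]inE [RHS]inE region_above.
Qed.

Lemma card_region0 x0 :
  #|{: point E}| = #|[set y | region T y == set0]| +
    \sum_(e in T) (seq_length (D @: T) (D e)).*2.
Proof.
have [_ r_cases _] := laminar_faces x0.
rewrite -[LHS]sum1_card (partition_big (region T) (mem (set0 |: above @: T))) /=; last first.
  move=> x _; apply/setU1P; case: (r_cases x) => [|[e eT ->]]; first by left.
  by right; apply: imset_f.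
rewrite big_setU1 /=; last first.
  by apply/imsetP => -[e eT /setP/(_ e)]; rewrite !inE eT subxx.
rewrite (big_imset _ above_inj) /=; congr (_ + _).
  by rewrite -sum1_card; apply: eq_bigl => x; rewrite inE.
apply: eq_bigr => e eT; rewrite -(card_above eT) -sum1_card.
by apply: eq_bigl => x; rewrite inE.
Qed.

End Laminar.

End Regions.

(** * Edge sets with the largest number of faces *)

Section MaximalFaces.

Variables (E : finType) (H : ribbon_graph E) (p : seq (point E)).
Variable D : E -> {set arrow E}.
Hypothesis p_cycle : fcycle (link H \o @across E) p.
Hypothesis p_uniq : uniq [seq x.1 | x <- p].
Hypothesis p_all : forall a : arrow E, a \in [seq x.1 | x <- p].
Hypothesis H_conn : forall x y, face H set0 x = face H set0 y.
Hypothesis D_arc : forall e, exists b, D e = arrow_arc [seq x.1 | x <- p] e b.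
Hypothesis D_short : forall e, #|D e| <= #|~: D e|.
Variable T : {set E}.
Hypothesis T_faces : faces H T = #|T|.+1.

Implicit Types (e f : E) (B : {set E}).

(** Each edge of [T] outside [B] adds at most one face, so [B] already attains its own bound. *)
Lemma faces_maximal B : B \subset T -> faces H B = #|B|.+1.
Proof.
move=> sBT; apply/eqP; rewrite eqn_leq faces_le //=.
have := faces_subset H sBT; rewrite T_faces -(cardsID B T) (setIidPr sBT).
by rewrite -addSn leq_add2r.
Qed.

(* Were e not two-sided, its two end points x and [side x] on the face X of
   (V, {e}) would lie on the same side of the bipartition of the points into
   entries and exits: [link] balances X with respect to it, while [across]
   balances X without these two points. *)
Lemma maximal_two_sided e : e \in T -> two_sided p e.
Proof.
move=> eT x xe; have seT : [set e] \subset T by rewrite sub1set.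
have tog f : (f \in set0) = (f \in [set e]) (+) (f == e) by rewrite !inE addbb.
have lt01 : faces H set0 < faces H [set e].
  by rewrite !faces_maximal ?sub0set // cards0 cards1.
(* Removing [e] lowers the number of faces, so its two free sides lie on different faces. *)
have across_out y : edge_of y = e -> face H [set e] y <> face H [set e] (across y).
  by move=> ye; have := face_toggle_join tog lt01 ye; rewrite [turn set0 y]/turn inE.
have [//|same] := eqVneq (side x \in p) (x \notin p).
have {}same : (side x \in p) = (x \in p).
  by case: (side x \in p) (x \in p) same => [] [].
pose X := face H [set e] x; pose o y := (y \in p) == (x \in p).
have xX : x \in X by apply/faceP.
have turnX y : y \in X -> turn [set e] y \in X.
  by move=> /faceP yX; apply/faceP; rewrite face_turn.
have sxX : side x \in X by have := turnX x xX; rewrite /turn xe set11.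
have edgeX y : y \in X -> y != x -> y != side x -> edge_of y != e.
  move=> yX yx ysx; apply/eqP => ye; have [] := same_edge (etrans xe (esym ye)) => yE.
  - by rewrite yE eqxx in yx.
  - by move/faceP: yX; rewrite yE; apply: across_out.
  - by rewrite yE eqxx in ysx.
  by move/faceP: yX; move/faceP: sxX => ->; rewrite yE; apply: across_out.
have balX : #|[set y in X | o y]| = #|[set y in X | ~~ o y]|.
  apply: (card_alternating (@link_invol _ H)) => y.
    by rewrite /o (reading_link p_cycle p_uniq p_all); case: (y \in p); case: (x \in p).
  by move=> /faceP yX; apply/faceP; rewrite face_link.
pose X' := X :\ x :\ side x.
have balX' : #|[set y in X' | o y]| = #|[set y in X' | ~~ o y]|.
  apply: (card_alternating (turnK [set e])) => y; rewrite !in_setD1 => /and3P[ysx yx yX].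
    rewrite /o /turn inE (negPf (edgeX y yX yx ysx)).
    by rewrite (reading_across p_uniq p_all); case: (y \in p); case: (x \in p).
  rewrite turnX // andbT; have ye := edgeX y yX yx ysx.
  by apply/andP; split; apply: contra ye => /eqP tE;
    rewrite -(edge_turn [set e]) tE ?edge_side xe.
have ox : o x by rewrite /o eqxx.
have osx : o (side x) by rewrite /o same.
have x1 : x \in [set y in X | o y] by rewrite in_set xX.
have x2 : side x \in [set y in X | o y] :\ x by rewrite in_setD1 side_neq in_set sxX.
(* Both removed points satisfy [o], so the two balances contradict each other by two. *)
move: balX; rewrite (cardsD1 x) x1 (cardsD1 (side x)) x2.
have -> : [set y in X | o y] :\ x :\ side x = [set y in X' | o y].
  by apply/setP => y; rewrite !(in_setD1, in_set) !andbA.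
have -> : [set y in X | ~~ o y] = [set y in X' | ~~ o y].
  apply/setP => y; rewrite !(in_setD1, in_set); have [->|] := eqVneq y x.
    by rewrite ox !andbF.
  by have [->|] := eqVneq y (side x); rewrite ?osx ?andbF.
by rewrite balX' => /eqP; rewrite addnA -[eqbRHS]add0n eqn_add2r.
Qed.

(** Removing [f] from [{e, f}] merges two faces, so by [face_bridge] the ends of each free side of
    [f] share a face of [(H, {e})], on which [inside e] is constant. *)
Lemma maximal_uncrossed : {in T &, forall e f, e != f -> uncrossed H p D e f}.
Proof.
move=> e f eT fT ef x xf.
have tog g : (g \in [set e]) = (g \in [set e; f]) (+) (g == f).
  rewrite !inE; case: (eqVneq g f) => [->|_]; last by rewrite orbF addbF.
  by rewrite eq_sym (negPf ef).
have sefT : [set e; f] \subset T by rewrite subUset !sub1set eT.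
have lt : faces H [set e] < faces H [set e; f].
  by rewrite !faces_maximal ?sub1set // cards2 cards1 ef.
have := face_bridge tog xf (face_toggle_join tog lt xf).
rewrite [turn _ x]/turn xf !inE eqxx orbT => /(face_region p_cycle p_uniq p_all D_arc).
have te1 : {in [set e], forall e, two_sided p e}.
  by move=> g /set1P->; apply: maximal_two_sided.
have te2 : {in [set e] &, forall g h, g != h -> uncrossed H p D g h}.
  by move=> g h /set1P-> /set1P->; rewrite eqxx.
by move=> /(_ te1 te2)/setP/(_ e); rewrite !inE eqxx.
Qed.

Lemma maximal_nested : {in T &, forall e f, nested_or_disjoint D e f}.
Proof.
move=> e f eT fT; have [->|ef] := eqVneq e f; first by rewrite /nested_or_disjoint subxx.
have sefT : [set e; f] \subset T by rewrite subUset !sub1set eT.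
pose g x := (inside H p D e x, inside H p D f x).
have gF x y : face H [set e; f] x = face H [set e; f] y -> g x = g y.
  move/(face_region p_cycle p_uniq p_all D_arc) => rE.
  have /setP rxy : region H p D [set e; f] x = region H p D [set e; f] y.
    apply: rE => [h|h i] /(subsetP sefT) hT; first exact: maximal_two_sided.
    by move=> /(subsetP sefT); apply: maximal_uncrossed.
  have := rxy f; have := rxy e; rewrite !inE !eqxx orbT /= /g => -> ->.
  by [].
(* Three faces give at most three of the four pairs of truth values; the missing pair decides how
   the sequences lie. *)
have [[c d] cd] : exists v, v \notin g @: [set: point E].
  apply/existsP; rewrite -negb_forall; apply/negP => /forallP gT.
  have := leq_card_image gF; rewrite -/(faces H _) faces_maximal // cards2 ef.
  suff -> : g @: [set: point E] = setT by rewrite cardsT card_prod card_bool.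
  by apply/setP => v; rewrite gT inE.
have {}cd a : (a \in D e, a \in D f) <> (c, d).
  move=> ae; case/negP: cd; apply/imsetP; exists (exit_point p a) => //.
  by rewrite /g /inside arc_start_exit.
apply/or3P; case: c d cd => [] [] cd.
- constructor 3; rewrite -setI_eq0; apply/eqP/setP => a; rewrite !inE.
  by have := cd a; case: (a \in D e) (a \in D f) => [] [].
- constructor 1; apply/subsetP => a ae.
  by have := cd a; rewrite ae; case: (a \in D f).
- constructor 2; apply/subsetP => a af.
  by have := cd a; rewrite af; case: (a \in D e).
(* The two sequences cover the circle; each has at most half of the arrows, so they are
   complementary. *)
constructor 3; have cover : ~: D e \subset D f.
  by apply/subsetP => a; rewrite inE; have := cd a; case: (a \in D e) (a \in D f) => [] [].
have cover' : ~: D f \subset D e by rewrite -setCS setCK.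
rewrite disjoints_subset; suff -> : D f = ~: D e by rewrite setCK.
apply/esym/eqP; rewrite eqEcard cover.
apply: leq_trans (D_short f) _; apply: leq_trans (subset_leq_card cover') _.
exact: D_short.
Qed.

End MaximalFaces.

(** * Face sizes and sequence lengths *)

Section Bouquet.

Variables (E : finType) (H : ribbon_graph E) (p : seq (point E)).
Variable D : E -> {set arrow E}.
Hypothesis p_cycle : fcycle (link H \o @across E) p.
Hypothesis p_uniq : uniq [seq x.1 | x <- p].
Hypothesis p_all : forall a : arrow E, a \in [seq x.1 | x <- p].
Hypothesis H_conn : forall x y, face H set0 x = face H set0 y.
Hypothesis D_arc : forall e, exists b, D e = arrow_arc [seq x.1 | x <- p] e b.
Variables (T : {set E}) (k : nat).
Hypothesis T_two : {in T, forall e, two_sided p e}.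
Hypothesis T_nested : {in T &, forall e f, nested_or_disjoint D e f}.

Lemma card_point : #|{: point E}| = (2 * #|E|).*2.
Proof. by rewrite !card_prod card_bool !muln2 mul2n. Qed.

(** With [n = #|T|] and [m = #|E|], each innermost part has [2k] of the [4m] end points, which
    leaves [4m - 2nk = 2k] for the outside of all sequences. *)
Lemma card_face_bouquet x :
  {in T, forall e, seq_length (D @: T) (D e) = k} -> #|T|.+1 * k = 2 * #|E| ->
  #|face H T x| = k.*2.
Proof.
move=> Tk nk; rewrite (card_face_region p_cycle p_uniq p_all H_conn D_arc T_two T_nested x).
have [_ cases _] := laminar_faces p_cycle p_uniq p_all H_conn D_arc T_two T_nested x.
case: (cases x) => [->|[e eT ->]]; last first.
  by rewrite (card_above p_cycle p_uniq p_all T_nested) // Tk.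
have := card_region0 p_cycle p_uniq p_all H_conn D_arc T_two T_nested x.
rewrite (eq_bigr (fun=> k.*2)) => [|e eT]; last by rewrite Tk.
rewrite sum_nat_const card_point -nk -doubleMr mulSn doubleD => /eqP.
by rewrite eqn_add2r eq_sym => /eqP.
Qed.

Lemma seq_length_bouquet e :
  (forall x, #|face H T x| = k.*2) -> e \in T -> seq_length (D @: T) (D e) = k.
Proof.
move=> Fk eT; have [x xE] := above_region p_cycle p_uniq p_all D_arc T_nested eT.
apply: double_inj; rewrite -(card_above p_cycle p_uniq p_all T_nested) // -xE.
by rewrite -(card_face_region p_cycle p_uniq p_all H_conn D_arc T_two T_nested x) Fk.
Qed.

End Bouquet.

Lemma card_faces_uniform (E : finType) (G : ribbon_graph E) (A : {set E}) k :
  (forall x, #|face G A x| = k.*2) -> faces G A * k = 2 * #|E|.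
Proof.
move=> Fk; apply: double_inj; rewrite -card_point -cardsT.
rewrite (card_uniform_partition (n := k.*2) _ (face_partition G A)) ?doubleMr //.
by move=> _ /imsetP[x _ ->]; apply: Fk.
Qed.

(** The rational equation includes the divisibility of [m] by [k]. *)
Lemma rat_count (n k m : nat) : 0 < k ->
  (n%:R = m%:R / k%:R - 1 :> rat)%R <-> n.+1 * k = m.
Proof.
move=> k_gt0; have k0 : (k%:R != 0 :> rat)%R by rewrite Num.Theory.pnatr_eq0 -lt0n.
split=> [nE|<-].
  apply/eqP; rewrite -(Num.Theory.eqr_nat rat) GRing.natrM -GRing.natr1 nE.
  by rewrite GRing.subrK GRing.divfK.
by rewrite GRing.natrM GRing.mulfK // -GRing.natr1 GRing.addrK.
Qed.

(** * Regularity and quasi-trees in terms of faces *)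

Section Regularity.

Variables (E : finType) (G : ribbon_graph E) (k : nat).
Hypothesis no_isolated : isolated G = 0.
Implicit Types (A Q : {set E}).

Lemma symdiff0 A : symdiff A set0 = A.
Proof. by apply/setP => e; rewrite in_symdiff inE addbF. Qed.

Lemma regular_faces A :
  regular k (partial_dual G A) <-> forall x, #|face G A x| = k.*2.
Proof.
have FA x : #|face (partial_dual G A) set0 x| = #|face G A (old_point A x)|.
  by rewrite card_face_dual symdiff0.
have mem v : (v \in vertices (partial_dual G A)) =
    (v \in face (partial_dual G A) set0 @: [set: point E]).
  by rewrite mem_vertices /= no_isolated andbF orbF.
split=> [reg x|Fk v].
  rewrite -[x](new_pointK A) -FA card_degree // reg // mem.
  exact: imset_f.
rewrite mem => /imsetP[x _ ->]; apply: double_inj.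
by rewrite -card_degree // FA Fk.
Qed.

Lemma quasi_tree_faces Q : spanning_quasi_tree G Q <-> faces G Q = 1.
Proof. by rewrite /spanning_quasi_tree size_components no_isolated addn0. Qed.

End Regularity.

Lemma connected_nonempty (E : finType) (G : ribbon_graph E) (x0 : point E) :
  connected G -> isolated G = 0 /\
  forall g : point E -> {set point E},
    (forall x, g (link G x) = g x) -> (forall x, g (across x) = g x) ->
    (forall x, g (side x) = g x) -> forall x y, g x = g y.
Proof.
rewrite /connected size_components; set r := (X in connect X); set P := _ @: _ => szP.
have P_gt0 : 0 < #|P| by apply/card_gt0P; exists [set y | connect r x0 y]; apply: imset_f.
have [P1 G0] : #|P| = 1 /\ isolated G = 0.
  by move: szP P_gt0; case: #|P| => [|[|n]] //; case: (isolated G).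
split=> // g gl ga gs x y.
have /card_le1_eqP P_le1 : #|P| <= 1 by rewrite P1.
have /setP/(_ y) : [set y | connect r x y] = [set z | connect r y z].
  by apply: P_le1; apply: imset_f.
rewrite !inE connect0; apply: connect_invariant => u v.
by case/or3P => /eqP->.
Qed.

Lemma reading_shorter (E : finType) (H : ribbon_graph E) s (D : E -> {set arrow E}) :
  cyclic_reading H s -> (forall e, shorter_sequence s e (D e)) ->
  exists p, [/\ fcycle (link H \o @across E) p, uniq [seq x.1 | x <- p],
    forall a : arrow E, a \in [seq x.1 | x <- p],
    forall e, exists b, D e = arrow_arc [seq x.1 | x <- p] e b
    & forall e, #|D e| <= #|~: D e|].
Proof.
case=> p [p_cycle -> p_uniq p_all] Ds; exists p; split=> // e.
  by have [b De _] := Ds e; exists b.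
have [b -> le_b] := Ds e; move: le_b.
by rewrite (arrow_arcC p_uniq p_all).
Qed.

Theorem theorem3p3 (E : finType) (G : ribbon_graph E) (k : nat) (A : {set E})
    (s : {set E} -> seq (arrow E)) (D : {set E} -> E -> {set arrow E})
    (G_connected : connected G) (k_gt0 : 0 < k)
    (s_reading : forall Q, spanning_quasi_tree G Q ->
       cyclic_reading (partial_dual G Q) (s Q))
    (D_shorter : forall Q, spanning_quasi_tree G Q ->
       forall e, shorter_sequence (s Q) e (D Q e)) :
  regular k (partial_dual G A) <->
  exists (Q : {set E}) (S : {set {set arrow E}}),
    [/\ spanning_quasi_tree G Q,
        shorter_sequence_set (partial_dual G Q) (D Q) S,
        (#|S|%:R = (2 * #|E|)%:R / k%:R - 1 :> rat)%R,
        forall C, C \in S -> seq_length S C = k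
      & A = symdiff Q (initial_edges (D Q) S)].
Proof.
(* Without edges both sides are false: [G] is one isolated vertex, of degree 0, and the equation for
   [#|S|] would make a positive multiple of [k] vanish. *)
case: (pickP E) => [e0 _|E0]; last first.
  have E_empty : #|E| = 0 by apply: eq_card0.
  have P0 : #|{: point E}| = 0 by rewrite card_point E_empty.
  split=> [reg|[Q [S [_ _ /(rat_count _ _ k_gt0) nk _ _]]]]; last first.
    by move: nk k_gt0; rewrite E_empty; case: k.
  have G1 : isolated G = 1.
    move: G_connected; rewrite /connected size_components.
    by have -> : [set: point E] = set0 by [apply/eqP; rewrite -cards_eq0 cardsT P0];
      rewrite imset0 cards0.
  have : set0 \in vertices (partial_dual G A) by rewrite mem_vertices /= G1 eqxx orbT.
  move/reg; rewrite /degree (_ : [set a | _] = set0) ?cards0 => [k0|].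
    by rewrite -k0 in k_gt0.
  by apply/setP => a; rewrite !inE.
pose x0 : point E := ((e0, false), false).
have [G0 G_conn] := connected_nonempty x0 G_connected.
have dual_conn Q : spanning_quasi_tree G Q ->
    forall x y, face (partial_dual G Q) set0 x = face (partial_dual G Q) set0 y.
  by move=> /(quasi_tree_faces G0) Q1; apply: faces_le1; rewrite faces_dual symdiff0 Q1.
split=> [/(regular_faces k G0) Fk|[Q [S [Q_tree S_set /(rat_count _ _ k_gt0) nk Sk ->]]]].
  have [T ltT Q1] := exists_quasi_tree G_conn x0 A.
  (* Then [A = symdiff Q T], and the faces of [T] in the bouquet correspond to those of [(G, A)]. *)
  pose Q := symdiff A T; exists Q, (D Q @: T).
  have Q_tree : spanning_quasi_tree G Q by apply/quasi_tree_faces.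
  have AE : A = symdiff Q T by apply/setP => e; rewrite !in_symdiff addbK.
  have H_conn := dual_conn Q Q_tree.
  have [p [p1 p2 p3 D_arc D_short]] :=
    reading_shorter (s_reading Q Q_tree) (D_shorter Q Q_tree).
  (* The lower bound is [#|T| < faces G A]; the upper bound holds in every bouquet. *)
  have facesT : faces (partial_dual G Q) T = #|T|.+1.
    by apply/eqP; rewrite eqn_leq faces_le //= faces_dual -AE.
  have T_two := maximal_two_sided p1 p2 p3 H_conn facesT.
  have T_nested := maximal_nested p1 p2 p3 H_conn D_arc D_short facesT.
  have D_inj := sequence_inj p1 p2 p3 D_arc.
  have ST : initial_edges (D Q) (D Q @: T) = T.
    by apply/setP => e; rewrite inE mem_imset.
  split=> //; last by rewrite ST.
  - split=> [|e|C1 C2].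
    + by apply/subsetP => _ /imsetP[e _ ->]; apply: imset_f.
    + by rewrite mem_imset // => eT; apply/(orientable_loopP p1 p2 p3 e H_conn)/T_two.
    by move=> /imsetP[e eT ->] /imsetP[f fT ->]; apply: T_nested.
  - apply/(rat_count _ _ k_gt0); rewrite card_imset //.
    by rewrite -(card_faces_uniform Fk) -facesT faces_dual -AE.
  move=> _ /imsetP[e eT ->].
  apply: (seq_length_bouquet p1 p2 p3 H_conn D_arc T_two T_nested) eT => x.
  by rewrite card_face_dual -AE.
have H_conn := dual_conn Q Q_tree.
have [p [p1 p2 p3 D_arc _]] := reading_shorter (s_reading Q Q_tree) (D_shorter Q Q_tree).
have D_inj := sequence_inj p1 p2 p3 D_arc.
have [/subsetP S_sub S_or S_nested] := S_set.
set T := initial_edges (D Q) S.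
(* Each member of [S] has exactly one initial edge, so sums and counts over [S] become sums and
   counts over [T]. *)
have ST : S = D Q @: T.
  apply/setP => C; apply/idP/imsetP => [CS|[e eT ->]]; last by rewrite inE in eT.
  by have /imsetP[e _ Ce] := S_sub C CS; exists e; rewrite // inE -Ce.
have T_two : {in T, forall e, two_sided p e}.
  by move=> e; rewrite inE => /S_or/(orientable_loopP p1 p2 p3 e H_conn).
have T_nested : {in T &, forall e f, nested_or_disjoint (D Q) e f}.
  by move=> e f; rewrite !inE; apply: S_nested.
apply/(regular_faces k G0) => x; rewrite -[x](new_pointK Q) -card_face_dual.
apply: (card_face_bouquet p1 p2 p3 H_conn D_arc T_two T_nested).
  by move=> e; rewrite inE -ST; apply: Sk.
by rewrite -nk [in RHS]ST card_imset.
Qed.
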